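(* Let $\mathbb F$ be a division ring, $A\in\mathbb F^{n\times n}$. (1) If the pair $(A,\mathbf v)$ with $\mathbf v\in\mathbb F^{n\times 1}$ is controllable, then its minimal polynomial is $$\mathfrak P_{A,\mathbf v}(z)=z^n-\mathfrak A_n(z)\,\mathfrak C_{A,\mathbf v}^{-1}A^n\mathbf v,$$ and furthermore $$\mathfrak C_{A,\mathbf v}^{-1}A\,\mathfrak C_{A,\mathbf v}=C_{\ell}(\mathfrak P_{A,\mathbf v}),\qquad \mathfrak C_{A,\mathbf v}^{-1}\mathbf v=\mathbf e_1,$$ i.e., the pair $(A,\mathbf v)$ is similar to the pair $(C_\ell(\mathfrak P_{A,\mathbf v}),\mathbf e_1)$. (2) If the pair $(\mathbf u,A)$ with $\mathbf u\in\mathbb F^{1\times n}$ is observable, then $$\mathfrak P_{\mathbf u,A}(z)=z^n-\mathbf uA^n\,\mathfrak O_{\mathbf u,A}^{-1}\mathfrak A_n(z)^\top,$$ and furthermore the pair $(\mathbf u,A)$ is similar to the pair $(\mathbf e_1^\top,C_{\mathbf r}(\mathfrak P_{\mathbf u,A}))$, as $$\mathfrak O_{\mathbf u,A}A\,\mathfrak O_{\mathbf u,A}^{-1}=C_{\mathbf r}(\mathfrak P_{\mathbf u,A}),\qquad \mathbf u\,\mathfrak O_{\mathbf u,A}^{-1}=\mathbf e_1^\top.$$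
   Context: $\mathbb F[z]$ is the ring of polynomials over $\mathbb F$ in a formal variable $z$ commuting with the coefficients. $\mathbf e_j$ is the $j$-th column of the identity matrix $\mathbf I_n$, and $\mathfrak A_n(z)=[1\ z\ \cdots\ z^{n-1}]$. For $f(z)=\sum_j f_jz^j$ put $(\mathbf v f)^{\mathfrak e_\ell}(A)=\sum_j A^j\mathbf v f_j$ and $(f\mathbf u)^{\mathfrak e_r}(A)=\sum_j f_j\mathbf uA^j$. $\mathfrak P_{A,\mathbf v}$ is the monic generator of the right ideal $\{p\in\mathbb F[z]:(\mathbf vp)^{\mathfrak e_\ell}(A)=0\}$; $\mathfrak P_{\mathbf u,A}$ is the monic generator of the left ideal $\{p\in\mathbb F[z]:(p\mathbf u)^{\mathfrak e_r}(A)=0\}$. $(A,\mathbf v)$ is controllable if $\mathfrak C_{A,\mathbf v}=[\mathbf v\ A\mathbf v\ \cdots\ A^{n-1}\mathbf v]$ is invertible; $(\mathbf u,A)$ is observable if the matrix $\mathfrak O_{\mathbf u,A}$ with rows $\mathbf u,\mathbf uA,\dots,\mathbf uA^{n-1}$ is invertible. For monic $p(z)=z^n+\sum_{k=0}^{n-1}p_kz^k$, the left companion matrix is $C_\ell(p)=[\mathbf e_2\ \mathbf e_3\ \cdots\ \mathbf e_n\ \ -\mathbf p]\in\mathbb F^{n\times n}$ with $\mathbf p=[p_0\ \cdots\ p_{n-1}]^\top$ and the right companion matrix is $C_{\mathbf r}(p)=C_\ell(p)^\top$ (plain transpose). Input pairs $(A,\mathbf v)$, $(A',\mathbf v')$ are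 similar if $A'=TAT^{-1}$, $\mathbf v'=T\mathbf v$ for some invertible $T$; output pairs $(\mathbf u,A)$, $(\mathbf u',A')$ are similar if $A'=TAT^{-1}$, $\mathbf u'=\mathbf uT^{-1}$ for some invertible $T$. *)

(* Defs.v *)
From HB Require Import structures.
From mathcomp Require Import all_boot all_algebra.
From mathcomp Require Import boolp classical_sets.

Set Implicit Arguments.
Unset Strict Implicit.
Unset Printing Implicit Defensive.

Import GRing.Theory.
Local Open Scope ring_scope.

(* MathComp has no division ring structure; [GRing.field_axiom] does not
   include commutativity, which only enters through [fieldType]. *)
Definition division_ring (F : unitRingType) : Prop := GRing.field_axiom F.

(* [unitmx] and [invmx] require commutative coefficients. *)
Definition is_mxinv (F : unitRingType) (n : nat) (M N : 'M[F]_n) : Prop :=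
  M *m N = 1%:M /\ N *m M = 1%:M.

Definition mx_invertible (F : unitRingType) (n : nat) (M : 'M[F]_n) : Prop :=
  exists N : 'M[F]_n, is_mxinv M N.

(* The two-sided inverse is unique when it exists; the value is 0 otherwise. *)
Definition mxinv (F : unitRingType) (n : nat) (M : 'M[F]_n) : 'M[F]_n :=
  xget 0 [set N | is_mxinv M N]%classic.

(* Right multiplication of a column by a scalar c is [_ *m c%:M], whereas
   [c *: _] is left multiplication. *)
Definition lev_col (F : unitRingType) (n : nat) (A : 'M[F]_n) (v : 'cV[F]_n)
    (f : {poly F}) : 'cV[F]_n :=
  \sum_(j < size f) (A ^+ j *m v) *m (f`_j)%:M.

Definition rev_row (F : unitRingType) (n : nat) (u : 'rV[F]_n) (A : 'M[F]_n)
    (f : {poly F}) : 'rV[F]_n :=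
  \sum_(j < size f) f`_j *: (u *m A ^+ j).

Definition monic_right_generator (F : unitRingType) (I : set {poly F})
    (g : {poly F}) : Prop :=
  g \is monic /\ I = [set g * q | q in [set: {poly F}]]%classic.

Definition monic_left_generator (F : unitRingType) (I : set {poly F})
    (g : {poly F}) : Prop :=
  g \is monic /\ I = [set q * g | q in [set: {poly F}]]%classic.

(* Over a division ring the monic generators below exist and are unique, so
   the default value 0 (which is not monic) is never taken. *)
Definition minpoly_in (F : unitRingType) (n : nat) (A : 'M[F]_n)
    (v : 'cV[F]_n) : {poly F} :=
  xget 0 [set g | monic_right_generator
                    [set p | lev_col A v p = 0]%classic g]%classic.

Definition minpoly_out (F : unitRingType) (n : nat) (u : 'rV[F]_n)
    (A : 'M[F]_n) : {poly F} :=
  xget 0 [set g | monic_left_generator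
                    [set p | rev_row u A p = 0]%classic g]%classic.

Definition ctrb_mx (F : unitRingType) (n : nat) (A : 'M[F]_n)
    (v : 'cV[F]_n) : 'M[F]_n :=
  \matrix_(i < n, j < n) (A ^+ j *m v) i 0.

Definition obsv_mx (F : unitRingType) (n : nat) (u : 'rV[F]_n)
    (A : 'M[F]_n) : 'M[F]_n :=
  \matrix_(i < n, j < n) (u *m A ^+ i) 0 j.

Definition controllable (F : unitRingType) (n : nat) (A : 'M[F]_n)
    (v : 'cV[F]_n) : Prop :=
  mx_invertible (ctrb_mx A v).

Definition observable (F : unitRingType) (n : nat) (u : 'rV[F]_n)
    (A : 'M[F]_n) : Prop :=
  mx_invertible (obsv_mx u A).

(* The size n is explicit; only used for p monic of degree n. MathComp's
   [companionmx p] is of size [(size p).-1] and is the right companion. *)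
Definition lcompanion (F : unitRingType) (n : nat) (p : {poly F}) : 'M[F]_n :=
  \matrix_(i < n, j < n)
    if j.+1 == n then - p`_i else ((i : nat) == j.+1)%:R.

Definition rcompanion (F : unitRingType) (n : nat) (p : {poly F}) : 'M[F]_n :=
  (lcompanion n p)^T.

Definition input_similar (F : unitRingType) (n : nat) (A : 'M[F]_n)
    (v : 'cV[F]_n) (A' : 'M[F]_n) (v' : 'cV[F]_n) : Prop :=
  exists T : 'M[F]_n, [/\ mx_invertible T,
    A' = T *m A *m mxinv T & v' = T *m v].

Definition output_similar (F : unitRingType) (n : nat) (u : 'rV[F]_n)
    (A : 'M[F]_n) (u' : 'rV[F]_n) (A' : 'M[F]_n) : Prop :=
  exists T : 'M[F]_n, [/\ mx_invertible T,
    A' = T *m A *m mxinv T & u' = u *m mxinv T].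

Definition zrow (F : unitRingType) (n : nat) : 'rV[{poly F}]_n :=
  \row_(j < n) 'X^j.

Definition e1 (F : unitRingType) (n : nat) : 'cV[F]_n.+1 := delta_mx 0 0.

(* Main.v *)
Require Import Defs.
From HB Require Import structures.
From mathcomp Require Import all_boot all_algebra.
From mathcomp Require Import boolp classical_sets zify.

(* Left evaluation p |-> lev_col A v p is multiplicative in the sense that
   evaluating p * q at v amounts to evaluating q at the value of p, so every
   right multiple of an annihilating polynomial annihilates.  When the
   controllability matrix C is invertible, the value of a polynomial of size at
   most n is C times its coefficient column, so no nonzero such polynomial
   annihilates; and z^n minus the polynomial with coefficients C^-1 A^n v does.
   Euclidean division by this monic polynomial, with the quotient on the
   right, shows that it generates the annihilator.  The companion form just
   says that A sends column j of C to column j+1 and the last one to A^n v.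
   Observability is the mirror image; transposition does not reduce it to the
   first part, because F is not commutative. *)

Set Implicit Arguments.
Unset Strict Implicit.
Unset Printing Implicit Defensive.

Import GRing.Theory.
Local Open Scope ring_scope.

(** * Two-sided inverses of matrices *)

Lemma is_mxinv_unique (F : unitRingType) (n : nat) (M N N' : 'M[F]_n) :
  is_mxinv M N -> is_mxinv M N' -> N = N'.
Proof.
by move=> [_ NM] [MN' _]; rewrite -[N]mulmx1 -MN' mulmxA NM mul1mx.
Qed.

Lemma mxinvE (F : unitRingType) (n : nat) (M N : 'M[F]_n) :
  is_mxinv M N -> mxinv M = N.
Proof.
by move=> MN; apply: xget_unique => // N' MN'; exact: is_mxinv_unique MN' MN.
Qed.

Lemma mxinvP (F : unitRingType) (n : nat) (M : 'M[F]_n) :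
  mx_invertible M -> is_mxinv M (mxinv M).
Proof. by move=> [N MN]; rewrite (mxinvE MN). Qed.

Lemma is_mxinv_sym (F : unitRingType) (n : nat) (M N : 'M[F]_n) :
  is_mxinv M N -> is_mxinv N M.
Proof. by case. Qed.

(** * Division by monic polynomials and uniqueness of monic generators *)

Lemma poly_left_division (R : nzRingType) (g p : {poly R}) : g \is monic ->
  exists q r : {poly R}, p = g * q + r /\ (size r < size g)%N.
Proof.
move=> g_monic; have [m] := ubnP (size p).
elim: m => // m IHm in p * => lt_p_m.
have [lt_p_g | le_g_p] := ltnP (size p) (size g).
  by exists 0, p; rewrite mulr0 add0r.
have g0 : (0 < size g)%N by rewrite size_poly_gt0 monic_neq0.
have p_gt0 := leq_trans g0 le_g_p.
have lp0 : lead_coef p != 0 by rewrite lead_coef_eq0 -size_poly_gt0.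
(* The quotient stands to the right of [g]. Because [g] is monic, [g * t] has the size and the
   leading coefficient of [p], so subtracting it lowers the size. *)
pose t := lead_coef p *: 'X^(size p - size g).
have lt : lead_coef t = lead_coef p.
  by rewrite /t -mul_polyC lead_coef_Mmonic ?monicXn ?lead_coefC.
have t0 : t != 0 by rewrite -lead_coef_eq0 lt.
have size_t : size t = (size p - size g).+1.
  rewrite /t -mul_polyC size_Mmonic ?monicXn ?polyC_eq0 //.
  by rewrite size_polyC lp0 size_polyXn.
have size_gt : size (g * t) = size p.
  by rewrite size_monicM // size_t addnS /= subnKC.
have lt_pt : (size (p - g * t)%R < size p)%N.
  rewrite ltn_neqAle; apply/andP; split; last first.
    by rewrite (leq_trans (size_polyD _ _)) // size_polyN size_gt maxnn.
  (* If the size did not drop, the leading coefficient of [p - g * t] would be the difference of two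
     equal leading coefficients, so [p - g * t] and then [p] would vanish. *)
  apply: contraNneq lp0 => eq_size.
  have : p - g * t == 0.
    rewrite -lead_coef_eq0 {1}/lead_coef eq_size coefB -{2}size_gt.
    by rewrite -!lead_coefE lead_coef_monicM // lt subrr.
  by rewrite -size_poly_eq0 eq_size size_poly_eq0 lead_coef_eq0.
have [q [r [defp ltr]]] := IHm _ (leq_trans lt_pt lt_p_m).
by exists (t + q), r; rewrite mulrDr -addrA -defp addrC subrK.
Qed.

Lemma monic_size1 (R : nzRingType) (q : {poly R}) :
  lead_coef q = 1 -> (size q <= 1)%N -> q = 1.
Proof.
by move=> + /size1_polyC def_q; rewrite def_q lead_coefC => ->.
Qed.

(** A size count: multiplying by a monic factor adds degrees, so the cofactor [q] is constant, and
    comparing leading coefficients makes it 1. *)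
Lemma monic_right_associates (R : nzRingType) (g h q q' : {poly R}) :
  g \is monic -> h \is monic -> g = h * q -> h = g * q' -> g = h.
Proof.
move=> g_monic h_monic def_g def_h.
have lq : lead_coef q = 1.
  by rewrite -(lead_coef_monicM q h_monic) -def_g; apply/monicP.
have q0 : q != 0 by rewrite -lead_coef_eq0 lq oner_eq0.
have q'0 : q' != 0.
  apply: contraTneq h_monic => q'0.
  by rewrite def_h q'0 mulr0 monicE lead_coef0 eq_sym oner_eq0.
have := congr1 (size : {poly R} -> nat) def_g.
have := congr1 (size : {poly R} -> nat) def_h.
rewrite !size_monicM // => size_h size_g.
rewrite def_g (monic_size1 lq) ?mulr1 //.
(* The two size equations give [size q + size q' = 2], with no predecessor truncated at 0; since
   [q'] is nonzero, [size q <= 1]. *)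
have h_gt0 : (0 < size h)%N by rewrite size_poly_gt0 monic_neq0.
by rewrite -size_poly_gt0 in q'0; lia.
Qed.

Lemma monic_left_associates (R : nzRingType) (g h q q' : {poly R}) :
  g \is monic -> h \is monic -> g = q * h -> h = q' * g -> g = h.
Proof.
move=> g_monic h_monic def_g def_h.
have lq : lead_coef q = 1.
  by rewrite -(lead_coef_Mmonic q h_monic) -def_g; apply/monicP.
have q0 : q != 0 by rewrite -lead_coef_eq0 lq oner_eq0.
have q'0 : q' != 0.
  apply: contraTneq h_monic => q'0.
  by rewrite def_h q'0 mul0r monicE lead_coef0 eq_sym oner_eq0.
have := congr1 (size : {poly R} -> nat) def_g.
have := congr1 (size : {poly R} -> nat) def_h.
rewrite !size_Mmonic // => size_h size_g.
rewrite def_g (monic_size1 lq) ?mul1r //.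
have h_gt0 : (0 < size h)%N by rewrite size_poly_gt0 monic_neq0.
by rewrite -size_poly_gt0 in q'0; lia.
Qed.

Lemma monic_right_generator_unique (F : unitRingType) (I : set {poly F})
    (g h : {poly F}) :
  monic_right_generator I g -> monic_right_generator I h -> g = h.
Proof.
move=> [g_monic Ig] [h_monic Ih].
have [q _ def_g] : [set h * q | q in [set: {poly F}]]%classic g.
  by rewrite -Ih Ig; exists 1; rewrite ?mulr1.
have [q' _ def_h] : [set g * q | q in [set: {poly F}]]%classic h.
  by rewrite -Ig Ih; exists 1; rewrite ?mulr1.
exact: (@monic_right_associates _ g h q q').
Qed.

Lemma monic_left_generator_unique (F : unitRingType) (I : set {poly F})
    (g h : {poly F}) :
  monic_left_generator I g -> monic_left_generator I h -> g = h.
Proof.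
move=> [g_monic Ig] [h_monic Ih].
have [q _ def_g] : [set q * h | q in [set: {poly F}]]%classic g.
  by rewrite -Ih Ig; exists 1; rewrite ?mul1r.
have [q' _ def_h] : [set q * g | q in [set: {poly F}]]%classic h.
  by rewrite -Ig Ih; exists 1; rewrite ?mul1r.
exact: (@monic_left_associates _ g h q q').
Qed.

(** [xget] returns some element of a nonempty set; uniqueness of the monic generator identifies it
    with [g]. *)
Lemma minpoly_inE (F : unitRingType) (n : nat) (A : 'M[F]_n) (v : 'cV[F]_n)
    (g : {poly F}) :
  monic_right_generator [set p | lev_col A v p = 0]%classic g ->
  minpoly_in A v = g.
Proof.
move=> gP; apply: xget_unique => // h hP.
exact: monic_right_generator_unique hP gP.
Qed.

Lemma minpoly_outE (F : unitRingType) (n : nat) (u : 'rV[F]_n) (A : 'M[F]_n)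
    (g : {poly F}) :
  monic_left_generator [set p | rev_row u A p = 0]%classic g ->
  minpoly_out u A = g.
Proof.
move=> gP; apply: xget_unique => // h hP.
exact: monic_left_generator_unique hP gP.
Qed.

(** * Left and right evaluation of polynomials *)

Lemma mulmx_scalarDr (R : pzRingType) (m n : nat) (B : 'M[R]_(m, n)) (a b : R) :
  B *m (a + b)%:M = B *m a%:M + B *m b%:M.
Proof. by rewrite raddfD mulmxDr. Qed.

(** Coefficients beyond the size are 0. A common summation bound allows termwise comparison of
    polynomials of different sizes. *)
Lemma lev_col_wide (F : unitRingType) (n m : nat) (A : 'M[F]_n) (v : 'cV[F]_n)
    (p : {poly F}) : (size p <= m)%N ->
  lev_col A v p = \sum_(j < m) (A ^+ j *m v) *m (p`_j)%:M.
Proof.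
move=> le_p_m; rewrite /lev_col.
rewrite (big_ord_widen _ (fun j : nat => (A ^+ j *m v) *m (p`_j)%:M) le_p_m).
rewrite big_mkcond; apply: eq_bigr => j _; case: ltnP => // le_pj.
by rewrite nth_default // raddf0 mulmx0.
Qed.

Lemma rev_row_wide (F : unitRingType) (n m : nat) (u : 'rV[F]_n) (A : 'M[F]_n)
    (p : {poly F}) : (size p <= m)%N ->
  rev_row u A p = \sum_(j < m) p`_j *: (u *m A ^+ j).
Proof.
move=> le_p_m; rewrite /rev_row.
rewrite (big_ord_widen _ (fun j : nat => p`_j *: (u *m A ^+ j)) le_p_m).
rewrite big_mkcond; apply: eq_bigr => j _; case: ltnP => // le_pj.
by rewrite nth_default // scale0r.
Qed.

Lemma lev_colD (F : unitRingType) (n : nat) (A : 'M[F]_n) (v : 'cV[F]_n)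
    (p q : {poly F}) : lev_col A v (p + q) = lev_col A v p + lev_col A v q.
Proof.
rewrite !(@lev_col_wide _ _ (maxn (size p) (size q))) ?leq_maxl ?leq_maxr //.
  by rewrite -big_split; apply: eq_bigr => j _; rewrite coefD mulmx_scalarDr.
exact: size_polyD.
Qed.

Lemma rev_rowD (F : unitRingType) (n : nat) (u : 'rV[F]_n) (A : 'M[F]_n)
    (p q : {poly F}) : rev_row u A (p + q) = rev_row u A p + rev_row u A q.
Proof.
rewrite !(@rev_row_wide _ _ (maxn (size p) (size q))) ?leq_maxl ?leq_maxr //.
  by rewrite -big_split; apply: eq_bigr => j _; rewrite coefD scalerDl.
exact: size_polyD.
Qed.

Lemma lev_colMC (F : unitRingType) (n : nat) (A : 'M[F]_n) (v : 'cV[F]_n)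
    (p : {poly F}) (c : F) : lev_col A v (p * c%:P) = lev_col A v p *m c%:M.
Proof.
rewrite !(@lev_col_wide _ _ (size p)) //.
  rewrite mulmx_suml; apply: eq_bigr => j _.
  by rewrite coefMC scalar_mxM mulmxA.
apply: leq_trans (size_polyMleq _ _) _.
by rewrite size_polyC; case: (c != 0); rewrite ?addn1 ?addn0 ?leq_pred.
Qed.

Lemma rev_rowCM (F : unitRingType) (n : nat) (u : 'rV[F]_n) (A : 'M[F]_n)
    (p : {poly F}) (c : F) : rev_row u A (c%:P * p) = c *: rev_row u A p.
Proof.
rewrite mul_polyC !(@rev_row_wide _ _ (size p)) ?size_scale_leq //.
by rewrite scaler_sumr; apply: eq_bigr => j _; rewrite coefZ scalerA.
Qed.

Lemma size_mulX_leq (R : nzRingType) (p : {poly R}) :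
  (size (p * 'X)%R <= (size p).+1)%N.
Proof.
by apply: leq_trans (size_polyMleq _ _) _; rewrite size_polyX addn2.
Qed.

Lemma lev_colMX (F : unitRingType) (n : nat) (A : 'M[F]_n) (v : 'cV[F]_n)
    (p : {poly F}) : lev_col A v (p * 'X) = A *m lev_col A v p.
Proof.
rewrite (lev_col_wide _ _ (size_mulX_leq p)) big_ord_recl coefMX.
rewrite raddf0 mulmx0 add0r.
rewrite mulmx_sumr; apply: eq_bigr => j _.
by rewrite coefMX /= !mulmxA -[A *m _]exprS.
Qed.

Lemma rev_rowMX (F : unitRingType) (n : nat) (u : 'rV[F]_n) (A : 'M[F]_n)
    (p : {poly F}) : rev_row u A (p * 'X) = rev_row u A p *m A.
Proof.
rewrite (rev_row_wide _ _ (size_mulX_leq p)) big_ord_recl coefMX scale0r add0r.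
rewrite mulmx_suml; apply: eq_bigr => j _.
by rewrite coefMX /= -scalemxAl -mulmxA -[A ^+ j *m A]exprSr.
Qed.

(** Induction on [q] in Horner form: a right factor ['X] acts on the value as [A] from the left, a
    right constant as a scalar from the right, and these two actions commute with no coefficient of
    [p] being moved. *)
Lemma lev_colM (F : unitRingType) (n : nat) (A : 'M[F]_n) (v : 'cV[F]_n)
    (p q : {poly F}) : lev_col A v (p * q) = lev_col A (lev_col A v p) q.
Proof.
elim/poly_ind: q => [|q c IHq].
  by rewrite mulr0 /lev_col size_poly0 !big_ord0.
rewrite mulrDr mulrA !lev_colD !lev_colMX lev_colMC IHq.
congr (_ + _); rewrite (lev_col_wide _ _ (size_polyC_leq1 c)) big_ord1.
by rewrite coefC eqxx expr0 mul1mx.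
Qed.

Lemma rev_rowM (F : unitRingType) (n : nat) (u : 'rV[F]_n) (A : 'M[F]_n)
    (p q : {poly F}) : rev_row u A (q * p) = rev_row (rev_row u A p) A q.
Proof.
elim/poly_ind: q => [|q c IHq].
  by rewrite mul0r /rev_row size_poly0 !big_ord0.
(* The Horner factor ['X] lies between [q] and [p]; it is central, so it can be moved to the right
   end, while the constant [c] stays on the left. *)
rewrite mulrDl -mulrA -commr_polyX mulrA !rev_rowD !rev_rowMX rev_rowCM IHq.
congr (_ + _); rewrite (rev_row_wide _ _ (size_polyC_leq1 c)) big_ord1.
by rewrite coefC eqxx expr0 mulmx1.
Qed.

Lemma lev_col0 (F : unitRingType) (n : nat) (A : 'M[F]_n) (p : {poly F}) :
  lev_col A 0 p = 0.
Proof. by rewrite /lev_col big1 // => j _; rewrite mulmx0 mul0mx. Qed.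

Lemma rev_row0 (F : unitRingType) (n : nat) (A : 'M[F]_n) (p : {poly F}) :
  rev_row 0 A p = 0.
Proof. by rewrite /rev_row big1 // => j _; rewrite mul0mx scaler0. Qed.

(** * Evaluation as a product with the controllability or observability matrix *)

Lemma lev_col_poly_rV (F : unitRingType) (n : nat) (A : 'M[F]_n) (v : 'cV[F]_n)
    (p : {poly F}) : (size p <= n)%N ->
  lev_col A v p = ctrb_mx A v *m (poly_rV p)^T.
Proof.
move=> le_p_n; rewrite (lev_col_wide _ _ le_p_n); apply/colP=> i.
rewrite summxE !mxE; apply: eq_bigr => j _.
(* Coefficients act from the right, so each one follows the matrix entry, as in the matrix
   product. *)
by rewrite !mxE big_ord1 !mxE eqxx.
Qed.

Lemma rev_row_poly_rV (F : unitRingType) (n : nat) (u : 'rV[F]_n) (A : 'M[F]_n)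
    (p : {poly F}) : (size p <= n)%N ->
  rev_row u A p = poly_rV p *m obsv_mx u A.
Proof.
move=> le_p_n; rewrite (rev_row_wide _ _ le_p_n); apply/rowP=> i.
by rewrite summxE !mxE; apply: eq_bigr => j _; rewrite !mxE.
Qed.

Lemma size_XnB_rVpoly (R : nzRingType) (n : nat) (c : 'rV[R]_n) :
  size ('X^n - rVpoly c) = n.+1.
Proof. by rewrite size_polyDl size_polyXn // size_polyN ltnS size_poly. Qed.

Lemma monic_XnB_rVpoly (R : nzRingType) (n : nat) (c : 'rV[R]_n) :
  'X^n - rVpoly c \is monic.
Proof.
rewrite monicE lead_coefDl ?lead_coefXn //.
by rewrite size_polyXn size_polyN ltnS size_poly.
Qed.

Lemma lev_col_Xn (F : unitRingType) (n : nat) (A : 'M[F]_n) (v : 'cV[F]_n)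
    (m : nat) :
  lev_col A v 'X^m = A ^+ m *m v.
Proof.
elim: m => [|m IHm]; last by rewrite exprSr lev_colMX IHm mulmxA -[A *m _]exprS.
by rewrite /lev_col expr0 size_poly1 big_ord1 coef1 mulmx1.
Qed.

Lemma rev_row_Xn (F : unitRingType) (n : nat) (u : 'rV[F]_n) (A : 'M[F]_n)
    (m : nat) :
  rev_row u A 'X^m = u *m A ^+ m.
Proof.
elim: m => [|m IHm]; last by rewrite !exprSr rev_rowMX IHm mulmxA.
by rewrite /rev_row expr0 size_poly1 big_ord1 coef1 scale1r.
Qed.

Lemma lev_colN (F : unitRingType) (n : nat) (A : 'M[F]_n) (v : 'cV[F]_n)
    (p : {poly F}) : lev_col A v (- p) = - lev_col A v p.
Proof.
by rewrite -[- p]mulrN1 -polyC1 -polyCN lev_colMC raddfN mulmxN mulmx1.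
Qed.

Lemma rev_rowN (F : unitRingType) (n : nat) (u : 'rV[F]_n) (A : 'M[F]_n)
    (p : {poly F}) : rev_row u A (- p) = - rev_row u A p.
Proof. by rewrite -[- p]mulN1r -polyC1 -polyCN rev_rowCM scaleN1r. Qed.

(** * Minimal polynomials of controllable and observable pairs *)

Lemma minpoly_in_ctrb (F : unitRingType) (n : nat) (A N : 'M[F]_n)
    (v : 'cV[F]_n) :
  is_mxinv (ctrb_mx A v) N ->
  minpoly_in A v = 'X^n - rVpoly (N *m A ^+ n *m v)^T.
Proof.
move=> [CN NC]; apply: minpoly_inE; set g := _ - _.
have g_monic : g \is monic by exact: monic_XnB_rVpoly.
have g0 : lev_col A v g = 0.
  rewrite lev_colD lev_colN lev_col_Xn lev_col_poly_rV ?size_poly //.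
  by rewrite rVpolyK trmxK -!mulmxA mulmxA CN mul1mx subrr.
split=> //; apply/seteqP; split=> [p /= p0|_ [q _ <-]] /=; last first.
  by rewrite lev_colM g0 lev_col0.
have [q [r [def_p lt_r_g]]] := poly_left_division p g_monic.
rewrite size_XnB_rVpoly ltnS in lt_r_g.
(* It remains to see that [r] is 0: it annihilates [v] and has size at most [n], so multiplying its
   value by [N] recovers its coefficients. *)
exists q; rewrite // def_p -[LHS]addr0; congr (_ + _); symmetry.
have : lev_col A v r = 0.
  by rewrite -p0 def_p lev_colD lev_colM g0 lev_col0 add0r.
rewrite lev_col_poly_rV // => /(congr1 (mulmx N)).
rewrite mulmxA NC mul1mx mulmx0 => r0.
by rewrite -(poly_rV_K lt_r_g) -[poly_rV r]trmxK r0 !linear0.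
Qed.

Lemma minpoly_out_obsv (F : unitRingType) (n : nat) (u : 'rV[F]_n)
    (A N : 'M[F]_n) :
  is_mxinv (obsv_mx u A) N ->
  minpoly_out u A = 'X^n - rVpoly (u *m A ^+ n *m N).
Proof.
move=> [ON NO]; apply: minpoly_outE; set g := _ - _.
have g_monic : g \is monic by exact: monic_XnB_rVpoly.
have g0 : rev_row u A g = 0.
  rewrite rev_rowD rev_rowN rev_row_Xn rev_row_poly_rV ?size_poly //.
  by rewrite rVpolyK -[_ *m N *m _]mulmxA NO mulmx1 subrr.
split=> //; apply/seteqP; split=> [p /= p0|_ [q _ <-]] /=; last first.
  by rewrite rev_rowM g0 rev_row0.
(* [rdivp] puts the quotient to the left of [g], which is the side required for a left ideal. *)
have def_p := Pdiv.RingMonic.rdivp_eq g_monic p.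
have := Pdiv.Ring.ltn_rmodpN0 p (monic_neq0 g_monic).
rewrite size_XnB_rVpoly ltnS.
move: (Pdiv.Ring.rmodp p g) (Pdiv.Ring.rdivp p g) def_p => r q def_p lt_r_g.
exists q; rewrite // def_p -[LHS]addr0; congr (_ + _); symmetry.
have : rev_row u A r = 0.
  by rewrite -p0 def_p rev_rowD rev_rowM g0 rev_row0 add0r.
rewrite rev_row_poly_rV // => /(congr1 (mulmxr N)) /=.
rewrite -mulmxA ON mulmx1 mul0mx => r0.
by rewrite -(poly_rV_K lt_r_g) r0 !linear0.
Qed.

(** * Coefficient vectors and the row of powers of the variable *)

Lemma rVpolyE (R : nzRingType) (n : nat) (c : 'rV[R]_n) :
  rVpoly c = \sum_(j < n) c 0 j *: 'X^j.
Proof.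
by rewrite /rVpoly poly_def; apply: eq_bigr => j _; rewrite valK.
Qed.

Lemma zrow_mul_polyC (F : unitRingType) (n : nat) (c : 'cV[F]_n) :
  (zrow F n *m map_mx polyC c) 0 0 = rVpoly c^T.
Proof.
rewrite rVpolyE mxE; apply: eq_bigr => j _.
(* Constants commute with powers of the variable, so the side on which the coefficients stand is
   immaterial here. *)
by rewrite !mxE -commr_polyXn mul_polyC.
Qed.

Lemma polyC_mul_zrow (F : unitRingType) (n : nat) (c : 'rV[F]_n) :
  (map_mx polyC c *m (zrow F n)^T) 0 0 = rVpoly c.
Proof.
by rewrite rVpolyE mxE; apply: eq_bigr => j _; rewrite !mxE mul_polyC.
Qed.

(** * Companion forms *)

Lemma col_ctrb_mx (F : unitRingType) (n : nat) (A : 'M[F]_n) (v : 'cV[F]_n)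
    (j : 'I_n) :
  col j (ctrb_mx A v) = A ^+ j *m v.
Proof. by apply/colP=> i; rewrite !mxE. Qed.

Lemma row_obsv_mx (F : unitRingType) (n : nat) (u : 'rV[F]_n) (A : 'M[F]_n)
    (i : 'I_n) :
  row i (obsv_mx u A) = u *m A ^+ i.
Proof. by apply/rowP=> j; rewrite !mxE. Qed.

Lemma row_rcompanion (F : unitRingType) (n : nat) (c : 'rV[F]_n.+1)
    (i : 'I_n.+1) :
  row i (rcompanion n.+1 ('X^(n.+1) - rVpoly c)) =
  if i == ord_max then c else delta_mx 0 (inord i.+1).
Proof.
apply/rowP=> j; rewrite !mxE eqSS -[n]/(ord_max : nat) -val_eqE /=.
case: eqVneq => [_ | neq_i_n].
  (* The leading power has degree [n.+1 > j] and does not contribute; the sign in the companion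
     matrix cancels the one in the polynomial. *)
  by rewrite coefB coefXn coef_rVpoly_ord ltn_eqF // sub0r opprK.
rewrite mxE eqxx /= -val_eqE /= inordK // ltnS ltn_neqAle neq_i_n -ltnS.
exact: ltn_ord.
Qed.

(** Row [i] of the left side is [u *m A ^+ i.+1]. Before the last row this is the next row of the
    observability matrix; in the last one, inserting [N *m obsv_mx u A = 1] expresses it through all
    rows. *)
Lemma obsv_mx_companion (F : unitRingType) (n : nat) (u : 'rV[F]_n.+1)
    (A N : 'M[F]_n.+1) : is_mxinv (obsv_mx u A) N ->
  obsv_mx u A *m A =
  rcompanion n.+1 ('X^(n.+1) - rVpoly (u *m A ^+ n.+1 *m N)) *m obsv_mx u A.
Proof.
move=> [_ NO]; apply/row_matrixP=> i.
rewrite !row_mul row_obsv_mx row_rcompanion -mulmxA -[A ^+ i *m A]exprSr.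
case: eqVneq => [-> | neq_i_n]; first by rewrite -mulmxA NO mulmx1.
rewrite -rowE row_obsv_mx inordK // ltnS ltn_neqAle -ltnS ltn_ord andbT.
exact: neq_i_n.
Qed.

Lemma ctrb_mx_companion (F : unitRingType) (n : nat) (A N : 'M[F]_n.+1)
    (v : 'cV[F]_n.+1) : is_mxinv (ctrb_mx A v) N ->
  A *m ctrb_mx A v =
  ctrb_mx A v *m lcompanion n.+1 ('X^(n.+1) - rVpoly (N *m A ^+ n.+1 *m v)^T).
Proof.
move=> [CN _]; apply/matrixP=> i j; set c := _^T.
suff: col j (A *m ctrb_mx A v) =
    col j (ctrb_mx A v *m lcompanion n.+1 ('X^(n.+1) - rVpoly c)).
  by move/colP/(_ i); rewrite !mxE.
rewrite !colE -!mulmxA -!colE col_ctrb_mx mulmxA -[A *m A ^+ j]exprS.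
(* Columns of the left companion are rows of the right one. Only a single matrix is transposed,
   never a product, so noncommutativity is harmless. *)
rewrite -[lcompanion _ _]trmxK -tr_row row_rcompanion.
case: eqVneq => [-> | neq_j_n]; first by rewrite trmxK !mulmxA CN mul1mx.
rewrite trmx_delta -colE col_ctrb_mx inordK //.
rewrite ltnS ltn_neqAle -ltnS ltn_ord andbT.
exact: neq_j_n.
Qed.

Lemma ctrb_mx_e1 (F : unitRingType) (n : nat) (A : 'M[F]_n.+1)
    (v : 'cV[F]_n.+1) :
  ctrb_mx A v *m e1 F n = v.
Proof. by rewrite -colE col_ctrb_mx mul1mx. Qed.

Lemma e1_obsv_mx (F : unitRingType) (n : nat) (u : 'rV[F]_n.+1)
    (A : 'M[F]_n.+1) :
  (e1 F n)^T *m obsv_mx u A = u.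
Proof. by rewrite trmx_delta -rowE row_obsv_mx mulmx1. Qed.

Theorem proposition3p2 (F : unitRingType) (divF : division_ring F)
    (n : nat) (A : 'M[F]_n.+1) :
  (forall v : 'cV[F]_n.+1, controllable A v ->
     let C := ctrb_mx A v in
     let P := minpoly_in A v in
     [/\ P = 'X^(n.+1)
             - (zrow F n.+1 *m map_mx polyC (mxinv C *m A ^+ n.+1 *m v)) 0 0,
         mxinv C *m A *m C = lcompanion n.+1 P,
         mxinv C *m v = e1 F n
       & input_similar A v (lcompanion n.+1 P) (e1 F n)])
  /\
  (forall u : 'rV[F]_n.+1, observable u A ->
     let Ob := obsv_mx u A in
     let P := minpoly_out u A in
     [/\ P = 'X^(n.+1)
             - (map_mx polyC (u *m A ^+ n.+1 *m mxinv Ob)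
                *m (zrow F n.+1)^T) 0 0,
         Ob *m A *m mxinv Ob = rcompanion n.+1 P,
         u *m mxinv Ob = (e1 F n)^T
       & output_similar u A (e1 F n)^T (rcompanion n.+1 P)]).
Proof.
split=> [v /mxinvP | u /mxinvP].
- move=> CN C P; have [CN1 NC1] := CN.
  have defP := minpoly_in_ctrb CN.
  have AC := ctrb_mx_companion CN; rewrite -defP in AC.
  have comp : mxinv C *m A *m C = lcompanion n.+1 P.
    by rewrite -mulmxA AC mulmxA NC1 mul1mx.
  have Nv : mxinv C *m v = e1 F n.
    by rewrite -[in LHS](ctrb_mx_e1 A v) mulmxA NC1 mul1mx.
  split=> //; first by rewrite zrow_mul_polyC.
  have NC := is_mxinv_sym CN.
  (* The similarity is [T = mxinv C], whose inverse is [C]; in the output case it is [Ob] itself. *)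
  by exists (mxinv C); split=> //; [exists C | rewrite (mxinvE NC)].
- move=> ON Ob P; have [ON1 NO1] := ON.
  have defP := minpoly_out_obsv ON.
  have OA := obsv_mx_companion ON; rewrite -defP in OA.
  have comp : Ob *m A *m mxinv Ob = rcompanion n.+1 P.
    by rewrite OA -mulmxA ON1 mulmx1.
  have uN : u *m mxinv Ob = (e1 F n)^T.
    by rewrite -[in LHS](e1_obsv_mx u A) -mulmxA ON1 mulmx1.
  split=> //; first by rewrite polyC_mul_zrow.
  by exists Ob; split=> //; exists (mxinv Ob).
Qed.
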